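(* For every prime power $q$ there is $n_0$ such that if $H$ is a $(q+1)$-graph on a set $X$ of $n>n_0$ vertices with $\delta_q(H)\ge n/2$ that does not contain $PG_2(q)$, then $n$ is even and there is a partition $X=X_0\cup X_1$ with $|X_0|=|X_1|=n/2$ such that no edge of $H$ is contained in $X_0$ and no edge of $H$ is contained in $X_1$.
   Context: For a $k$-graph $H$ and $S\subseteq V(H)$, $N_H(S)=\{T\subseteq V(H)\setminus S:S\cup T\in E(H)\}$ and $\delta_s(H)=\min_{|S|=s}|N_H(S)|$. ''Contains'' means as a (not necessarily induced) subgraph. $PG_2(q)$ is the $(q+1)$-graph whose vertices are the one-dimensional subspaces of $\mathbb{F}_q^3$ and whose edges are, for each two-dimensional subspace, the set of one-dimensional subspaces it contains. *)

(* Defs.v *)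
From HB Require Import structures.
From mathcomp Require Import all_boot all_order all_algebra all_fingroup all_field.
Set Implicit Arguments. Unset Strict Implicit. Unset Printing Implicit Defensive.
Import GRing.Theory.
Local Open Scope ring_scope.

Definition uniform (n k : nat) (E : {set {set 'I_n}}) : Prop :=
  forall e, e \in E -> #|e| = k.

Definition nbhd (n : nat) (E : {set {set 'I_n}}) (S : {set 'I_n}) : {set {set 'I_n}} :=
  [set T : {set 'I_n} | [disjoint T & S] && ((S :|: T) \in E)].

Definition min_codeg_half (n s : nat) (E : {set {set 'I_n}}) : Prop :=
  forall S : {set 'I_n}, #|S| = s -> (n <= 2 * #|nbhd E S|)%N.

Definition pg_point (F : finFieldType) (P : {set 'rV[F]_3}) : bool :=
  [exists v : 'rV[F]_3, (v != 0) && (P == [set a *: v | a : F])].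

Definition pg_plane (F : finFieldType) (L : {set 'rV[F]_3}) : bool :=
  [exists u : 'rV[F]_3, exists w : 'rV[F]_3,
     (\rank (col_mx u w) == 2)%N &&
     (L == [set a *: u + b *: w | a : F, b : F])].

Definition pg_line (F : finFieldType) (L : {set 'rV[F]_3}) : {set {set 'rV[F]_3}} :=
  [set P | pg_point P && (P \subset L)].

Definition contains_PG2_over (F : finFieldType) (n : nat) (E : {set {set 'I_n}}) : Prop :=
  exists f : {set 'rV[F]_3} -> 'I_n,
    {in [pred P : {set 'rV[F]_3} | pg_point P] &, injective f} /\
    forall L : {set 'rV[F]_3}, pg_plane L -> f @: pg_line L \in E.

(* H contains PG_2(q): for the (unique up to isomorphism) field of order q. *)
Definition contains_PG2 (q n : nat) (E : {set {set 'I_n}}) : Prop :=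
  exists F : finFieldType, #|F| = q /\ contains_PG2_over F E.

Definition prime_power (q : nat) : Prop :=
  exists p k : nat, prime p /\ (0 < k)%N /\ q = (p ^ k)%N.

(* Main.v *)
Require Import Defs.
From mathcomp Require Import all_boot all_order all_algebra all_fingroup all_field.
From mathcomp Require Import zify.
Set Implicit Arguments. Unset Strict Implicit. Unset Printing Implicit Defensive.

(* For a vertex set A, let common A and touched A be the intersection and the
   union of the neighbourhoods N(S) over the q-subsets S of A.  If |A| >= q^2,
   then common A is independent: an edge inside it would serve as the line at
   infinity of an affine plane placed arbitrarily in A.  If moreover
   2 |touched A| <= n, the codegree condition forces N(S) = common A = touched A
   for all S, so this set X1 is independent of size n/2; applied to a subset of
   X1, the same argument shows that the complement is independent too.

   To find such an A, first take a typical sample of constant size m: by a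
   Chernoff bound none of its independent sets is much larger than m/2.  A
   positive fraction of all m-tuples induces the same pattern, so Erdos's
   theorem on m-partite hypergraphs provides a blow-up of it.  The parts
   touched by a given vertex p form an independent set of the pattern, since
   otherwise p and q + 1 disjoint q-sets with all their transversals yield
   PG_2(q); averaging over p gives A with |touched A| <= (1/2 + eps) n.  Then
   I = common A and I' = common A', for A' inside I, are almost complementary
   independent sets of almost n/2 vertices.  Choose 2q parts in I and 2q parts
   in I' such that q vertices on one side and one on the other always form an
   edge.  Now every vertex touches at most 2q of the 4q parts, and averaging
   gives a part A with 2 |touched A| <= n, without error term. *)

(** * Counting and boxes in dense sets of tuples *)

Lemma exists_geq_average (I : finType) (P : pred I) (F : I -> nat) (c : nat) :
  (exists i, P i) -> c * #|P| <= \sum_(i | P i) F i -> exists2 i, P i & c <= F i.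
Proof.
move=> [i0 Pi0] le_c; case: (boolP [exists i, P i && (c <= F i)]).
  by case/existsP=> i /andP[]; exists i.
rewrite negb_exists => /forallP small.
have lt i : P i -> F i + 1 <= c.
  by move=> Pi; move: (small i); rewrite Pi /= -ltnNge addn1.
have := @leq_sum I (index_enum I) P _ _ lt.
rewrite big_split /= sum1_card sum_nat_const.
have : 0 < #|P| by apply/card_gt0P; exists i0.
by rewrite mulnC in le_c; lia.
Qed.

Lemma exists_leq_average (I : finType) (P : pred I) (F : I -> nat) (c : nat) :
  (exists i, P i) -> \sum_(i | P i) F i <= c * #|P| -> exists2 i, P i & F i <= c.
Proof.
move=> [i0 Pi0] le_c; case: (boolP [exists i, P i && (F i <= c)]).
  by case/existsP=> i /andP[]; exists i.
rewrite negb_exists => /forallP large.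
have lt i : P i -> c + 1 <= F i.
  by move=> Pi; move: (large i); rewrite Pi /= -ltnNge addn1.
have := @leq_sum I (index_enum I) P _ _ lt.
rewrite sum_nat_const.
have : 0 < #|P| by apply/card_gt0P; exists i0.
by rewrite mulnC in le_c; nia.
Qed.

Lemma exists_subset_card (T : finType) (A : {set T}) k :
  k <= #|A| -> exists2 S : {set T}, S \subset A & #|S| = k.
Proof.
rewrite -bin_gt0 -cards_draws => /card_gt0P[S]; rewrite inE => /andP[sSA /eqP cS].
by exists S.
Qed.

Lemma card_set_count (I J : finType) (A : {set I}) (B : {set J}) (r : I -> J -> bool) :
  \sum_(i in A) #|[set j in B | r i j]| = \sum_(j in B) #|[set i in A | r i j]|.
Proof.
under eq_bigr do rewrite -sum1_card big_mkcond /=.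
under [RHS]eq_bigr do rewrite -sum1_card big_mkcond /=.
rewrite exchange_big /= [RHS]big_mkcond /=; apply: eq_bigr => j _.
rewrite big_mkcond; case: ifP => Bj.
  rewrite big_mkcond [RHS]big_mkcond; apply: eq_bigr => i _.
  by rewrite !inE Bj; case: (i \in A); case: (r i j).
by apply: big1 => i _; rewrite !inE Bj; case: ifP.
Qed.

Lemma card_rel_count (I J : finType) (r : I -> J -> bool) :
  \sum_i #|[set j | r i j]| = \sum_j #|[set i | r i j]|.
Proof.
under eq_bigr do rewrite -sum1_card big_mkcond /=.
under [RHS]eq_bigr do rewrite -sum1_card big_mkcond /=.
rewrite exchange_big; apply: eq_bigr => j _; apply: eq_bigr => i _.
by rewrite !inE.
Qed.

Lemma leq_pow2r m n e : m <= n -> m ^ e <= n ^ e.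
Proof. by case: e => // e; rewrite leq_exp2r. Qed.

Lemma ffact_leq_exp n m : n ^_ m <= n ^ m.
Proof. by elim: m => // m IH; rewrite ffactnSr expnSr leq_mul // leq_subr. Qed.

Lemma exp_leq_ffact n m : (n - m) ^ m <= n ^_ m.
Proof.
elim: m => // m IH; rewrite ffactnSr expnSr leq_mul //; last by lia.
by apply: leq_trans IH; apply: leq_pow2r; lia.
Qed.

(** Compare falling factorials: [n ^_ t <= n ^ t] and [(d - t) ^ t <= d ^_ t]. *)
Lemma leq_bin_ratio c n d t : n <= c * (d - t) -> 'C(n, t) <= c ^ t * 'C(d, t).
Proof.
move=> le_n; rewrite -(leq_pmul2r (fact_gt0 t)) -mulnA !bin_ffact.
apply: leq_trans (ffact_leq_exp _ _) _; apply: leq_trans (leq_pow2r _ le_n) _.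
by rewrite expnMn leq_mul2l exp_leq_ffact orbT.
Qed.

(** Union bound with denominators cleared: a random map from [m] points to [n] points is injective
    with probability at least [1 - m ^ 2 / n]. Truncated subtraction makes the case [n < m ^ 2]
    trivial. *)
Lemma exp_leq_injective n m : n ^ m * (n - m ^ 2) <= n ^_ m * n.
Proof.
elim: m => [|m IH]; first by rewrite !expn0 ffactn0; nia.
rewrite ffactnSr expnSr; have [le_n|lt_n] := leqP (m.+1 ^ 2) n; last first.
  by rewrite (_ : n - _ = 0) ?muln0 //; nia.
apply: leq_trans (_ : n ^ m * (n - m ^ 2) * (n - m) <= _); last by nia.
by rewrite -!mulnA leq_mul2l; apply/orP; right; nia.
Qed.

Section Tuples.
Variables (X : finType) (m : nat).
Implicit Types (G : {set m.+1.-tuple X}) (y : m.-tuple X).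

Definition fibre G y := [set v | [tuple of v :: y] \in G].

Lemma card_fibres G : #|G| = \sum_(y : m.-tuple X) #|fibre G y|.
Proof.
rewrite -sum1_card (partition_big (fun x : m.+1.-tuple X => [tuple of behead x]) predT) //=.
apply: eq_bigr => y _; rewrite sum1_card.
have inj : injective (fun v => [tuple of v :: y]) by move=> u v /(congr1 val) [].
rewrite -[#|fibre G y|](card_imset _ inj).
apply: eq_card => x; rewrite unfold_in /=; apply/andP/imsetP => [[Gx /eqP <-]|[v]].
  by exists (thead x); rewrite /fibre ?inE -?tuple_eta.
by rewrite /fibre inE => Gv ->; split=> //; apply/eqP/val_inj.
Qed.
End Tuples.

(* Induction on the number of coordinates: a positive fraction of the y have
   a fibre of linear size, so some t-set T lies in the fibres of a positive
   fraction of the y. *)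
Lemma dense_tuples_contain_box (m t K : nat) :
  exists n0, forall (X : finType) (G : {set m.-tuple X}),
    n0 <= #|X| -> #|X| ^ m <= K * #|G| ->
    exists V : 'I_m -> {set X}, (forall i, #|V i| = t) /\
      forall x : m.-tuple X, (forall i, tnth x i \in V i) -> x \in G.
Proof.
elim: m K => [|m IH] K.
  exists 0 => X G _; rewrite expn0 => lt0; exists (fun=> set0); split=> [[]|x _] //.
  have /card_gt0P[z Gz] : 0 < #|G| by lia.
  by rewrite (tuple0 x) -(tuple0 z).
(* The set [Y] below has density at least [1 / (2 * K)], and [c] bounds the ratio of ['C(n, t)] to
   ['C(d, t)], where [d] is the guaranteed fibre size; so some [T] lies in the fibres of a [1 / c]
   share of [Y]. *)
set c := (4 * K) ^ t; have [n0 {}IH] := IH (2 * K * c).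
exists (n0 + 4 * K * t + 2 * K + t + 1) => X G le_n dense; set n := #|X| in le_n dense *.
pose Y := [set y : m.-tuple X | n <= 2 * K * #|fibre G y|].
have leY : n ^ m <= 2 * K * #|Y|.
  have : 2 * K * #|G| <= 2 * K * n * #|Y| + n * n ^ m.
    rewrite card_fibres big_distrr /= (bigID (mem Y)) /= leq_add //.
      rewrite [X in _ <= X]mulnC -sum_nat_const leq_sum // => y _.
      by rewrite leq_mul2l max_card orbT.
    rewrite -card_tuple [X in _ <= X]mulnC -(cardC (mem Y)) mulnDl addnC.
    apply: leq_trans (leq_addr _ _); rewrite -sum_nat_const leq_sum // => y.
    by rewrite inE -ltnNge => /ltnW.
  rewrite expnS in dense; have n_gt0 : 0 < n by lia.
  by move=> le2; rewrite -(leq_pmul2l n_gt0); nia.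
pose d := n %/ (2 * K).
have [K0|K_gt0] := posnP K; first by move: leY; rewrite K0 !mul0n leqn0 expn_eq0; lia.
have le_bin : 'C(n, t) <= c * 'C(d, t).
  apply: leq_bin_ratio.
  have : 2 * t + 1 <= d by rewrite leq_divRL; nia.
  have := divn_eq n (2 * K); have : n %% (2 * K) < 2 * K by rewrite ltn_mod; lia.
  by rewrite -/d; nia.
have [T /eqP cT leT] : exists2 T : {set X}, #|T| == t &
    #|Y| <= c * #|[set y in Y | T \subset fibre G y]|.
  apply: exists_geq_average.
    have : 0 < #|[set T : {set X} | T \subset [set: X] & #|T| == t]|.
      by rewrite cards_draws cardsT bin_gt0 -/n; lia.
    by case/card_gt0P=> T; rewrite !inE => /andP[_ ?]; exists T.
  have -> : #|[pred T : {set X} | #|T| == t]| = 'C(n, t).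
    rewrite /n -cardsT -cards_draws; apply: eq_card => T.
    by rewrite !inE subsetT.
  rewrite -big_distrr /=.
  rewrite (eq_bigl (fun T => T \in [set T : {set X} | #|T| == t])); last by move=> T; rewrite inE.
  rewrite card_set_count big_distrr /=.
  apply: leq_trans (_ : \sum_(y in Y) c * 'C(d, t) <= _).
    by rewrite sum_nat_const leq_mul2l le_bin orbT.
  apply: leq_sum => y; rewrite inE => le_y; rewrite leq_mul2l; apply/orP; right.
  rewrite (eq_card (_ : _ =i [set T : {set X} | T \subset fibre G y & #|T| == t])).
    rewrite cards_draws leq_bin2l // -(mulKn #|fibre G y| (_ : 0 < 2 * K)); last by lia.
    exact: leq_div2r.
  by move=> T; rewrite !inE andbC.
pose GT := [set y | T \subset fibre G y].
have [||V [cV subV]] := IH X GT; first by lia.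
  apply: leq_trans leY _; rewrite -[X in _ <= X]mulnA leq_mul2l; apply/orP; right.
  apply: leq_trans leT _; rewrite leq_mul2l; apply/orP; right; apply: subset_leq_card.
  by apply/subsetP=> y; rewrite !inE => /andP[].
exists (fun i => if unlift ord0 i is Some j then V j else T); split.
  by move=> i; case: (unlift _ i).
move=> x Vx; rewrite (tuple_eta x).
have : [tuple of behead x] \in GT.
  apply: subV => i; have := Vx (lift ord0 i); rewrite liftK.
  rewrite tnth_behead (_ : inord i.+1 = lift ord0 i) //.
  by apply: val_inj; rewrite /= inordK ?ltnS.
rewrite inE => /subsetP/(_ (thead x)); rewrite inE; apply.
by have := Vx ord0; rewrite unlift_none.
Qed.

(** * Random samples *)

(** Converse of Bernoulli's inequality, [(1 + 1/z)^j <= 1 + 2j/z], with denominators cleared. *)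
Lemma exp_succ_leq z j : 2 * j <= z -> z.+1 ^ j * z <= z ^ j * (z + 2 * j).
Proof.
elim: j => [|j IH] le_z; first by rewrite !expn0; lia.
rewrite !expnS -mulnA; apply: leq_trans (leq_mul (leqnn _) (IH _)) _; first by lia.
by rewrite mulnCA -!mulnA [z * _]mulnCA leq_mul2l; apply/orP; right; nia.
Qed.

(* The two sides of the exponential moment bound with weight (h + 1) / h on
   misses; their ratio governs the tail. *)
Definition tail_lo h := 4 ^ h * h.+1 ^ h.+1 * h ^ h.-1.
Definition tail_hi h := (2 * h).+1 ^ (2 * h).

(** With [z = 4h(h+1)], so that [z + 1 = (2h+1)^2], the two sides are [(z+1)^h] and [z^h (1 + 1/h)];
    and [(1 + 1/z)^h] is at most [1 + 2h/z = 1 + 1/(2(h+1))]. *)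
Lemma tail_ltn h : 0 < h -> tail_hi h < tail_lo h.
Proof.
move=> h_gt0; set z := 4 * h * h.+1.
have hiE : tail_hi h = z.+1 ^ h.
  by rewrite /tail_hi expnM; congr (_ ^ h); rewrite /z; nia.
have loE : tail_lo h * h = z ^ h * h.+1.
  have hh : h ^ h.-1 * h = h ^ h by rewrite -expnSr prednK.
  rewrite /tail_lo /z !expnMn -mulnA hh expnSr.
  by move: (4 ^ h) (h.+1 ^ h) (h ^ h) => A B C; lia.
rewrite -(ltn_pmul2r h_gt0) loE hiE.
have z_gt0 : 0 < z by rewrite /z; nia.
rewrite -(ltn_pmul2r z_gt0) mulnAC.
have : z.+1 ^ h * z <= z ^ h * (z + 2 * h) by apply: exp_succ_leq; rewrite /z; nia.
have zh_gt0 : 0 < z ^ h by rewrite expn_gt0 z_gt0.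
move=> le1; apply: leq_ltn_trans (leq_mul le1 (leqnn h)) _.
by rewrite -!mulnA ltn_pmul2l // /z; nia.
Qed.

(** Powers of a ratio above 1 outgrow any [D]; as [tail_hi h + 1 <= tail_lo h], Bernoulli's
    inequality [bern] gives an explicit exponent. *)
Lemma tail_small h D q : 0 < h -> exists s, [/\ 0 < s, q <= s & D * tail_hi h ^ s <= tail_lo h ^ s].
Proof.
move=> /tail_ltn lt_ba; set b := tail_hi h in lt_ba *.
have b_gt0 : 0 < b by rewrite expn_gt0.
have bern s : b ^ s * (b + s) <= b.+1 ^ s * b.
  elim: s => [|s IH]; first by rewrite !expn0; lia.
  rewrite !expnS; apply: leq_trans (_ : b.+1 * (b ^ s * (b + s)) <= _); last by nia.
  by rewrite mulnCA -mulnA mulnCA leq_mul2l; apply/orP; right; nia.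
exists (b * D + q + 1); split; try lia.
set s := _ + 1; have := bern s.
have : b.+1 ^ s <= tail_lo h ^ s by apply: leq_pow2r.
have : b * D <= b + s by rewrite /s; lia.
move=> le1 le2 le3; rewrite -(leq_pmul2r b_gt0).
apply: leq_trans (_ : b ^ s * (b * D) <= _); first by lia.
apply: leq_trans (leq_mul (leqnn _) le1) _; apply: leq_trans le3 _.
by rewrite leq_mul2r le2 orbT.
Qed.

(** Chernoff bound by exponential moments. With weight [h] on [N] and [h + 1] off it, the mean
    weight is at most [h + 1/2]; weights of independent coordinates multiply, and each counted
    sample has a large product. *)
Lemma card_many_misses (X : finType) (N : {set X}) h s :
  0 < h -> #|X| <= 2 * #|N| ->
  #|[set x : {ffun 'I_(2 * h * s) -> X} | h.+1 * s <= #|[set j | x j \notin N]| ]| * tail_lo h ^ s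
  <= #|X| ^ (2 * h * s) * tail_hi h ^ s.
Proof.
move=> h_gt0 leN; set m := 2 * h * s; set B := [set x | _].
pose w (v : X) := if v \in N then h else h.+1.
have sumw : 2 * \sum_v w v <= #|X| * (2 * h).+1.
  have -> : \sum_v w v = #|N| * h + #|~: N| * h.+1.
    rewrite -!sum_nat_const (bigID (fun v => v \in N)) /=; congr (_ + _).
      by apply: eq_bigr => v Nv; rewrite /w Nv.
    by apply: eq_big => v; rewrite ?inE // /w => /negPf ->.
  by have := cardsC N; move: leN; move: #|N| #|~: N| => u v; nia.
have prodw (x : {ffun 'I_m -> X}) : x \in B -> h.+1 ^ (h.+1 * s) * h ^ (h.-1 * s) <= \prod_j w (x j).
  rewrite inE; set Ms := [set j | _] => le_b.
  have -> : \prod_j w (x j) = h ^ #|~: Ms| * h.+1 ^ #|Ms|.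
    rewrite -!prod_nat_const (bigID (fun j => x j \in N)) /=; congr (_ * _).
      by apply: eq_big => j; rewrite ?inE ?negbK // /w => ->.
    by apply: eq_big => j; rewrite ?inE // /w => /negPf ->.
  have := cardsC Ms; rewrite card_ord.
  move: #|Ms| #|~: Ms| le_b => b a le_b ab.
  rewrite -(subnKC le_b) expnD mulnCA leq_mul2l; apply/orP; right.
  rewrite (_ : h.-1 * s = a + (b - h.+1 * s)); last by move: ab; rewrite /m; nia.
  by rewrite expnD leq_mul2l leq_pow2r ?orbT.
have sumB : #|B| * (h.+1 ^ (h.+1 * s) * h ^ (h.-1 * s)) <= (\sum_v w v) ^ m.
  rewrite -sum_nat_const; apply: leq_trans (@leq_sum _ _ _ _ _ prodw) _.
  rewrite -[m in X in _ <= X]card_ord -prod_nat_const bigA_distr_bigA /=.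
  by rewrite [X in _ <= X](bigID (mem B)) /= leq_addr.
have -> : tail_lo h ^ s = 2 ^ m * (h.+1 ^ (h.+1 * s) * h ^ (h.-1 * s)).
  by rewrite /tail_lo !expnMn -!expnM -mulnA /m (expnM 2) (expnM 2 2) -expnM.
have -> : #|X| ^ m * tail_hi h ^ s = (#|X| * (2 * h).+1) ^ m.
  by rewrite expnMn /tail_hi -expnM.
apply: leq_trans (leq_pow2r m sumw).
by rewrite expnMn mulnCA leq_mul2l sumB orbT.
Qed.

Section Sampling.
Variables (X : finType) (nb : {set X} -> {set X}) (q h s : nat).
Local Notation m := (2 * h * s).
Implicit Types (x : {ffun 'I_m -> X}) (J : {set 'I_m}).

(** Half of the [m] positions is [h * s], so the excess [s] over it is the share [1 / (2 * h)] of
    all positions. *)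
Definition deficient x J :=
  (#|x @: J| == q) && (h.+1 * s <= #|[set j in ~: J | x j \notin nb (x @: J)]|).

(* Exchanging the values on J of two independent samples makes the set
   sampled on J independent of the values off J. *)
Lemma card_deficient J (D : nat) : 0 < h -> 0 < #|X| ->
  (forall S : {set X}, #|S| = q -> #|X| <= 2 * #|nb S|) -> D * tail_hi h ^ s <= tail_lo h ^ s ->
  D * #|[set x | deficient x J]| <= #|X| ^ m.
Proof.
move=> h_gt0 X_gt0 codeg le_D.
pose mix x y := [ffun j => if j \in J then y j else x j] : {ffun 'I_m -> X}.
pose swap (p : {ffun 'I_m -> X} * {ffun 'I_m -> X}) := (mix p.1 p.2, mix p.2 p.1).
have swapK : involutive swap.
  by case=> x y; rewrite /swap /=; congr (_, _); apply/ffunP=> j; rewrite !ffunE; case: (j \in J).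
have mixJ x y : mix x y @: J = y @: J.
  by apply: eq_in_imset => j Jj; rewrite ffunE Jj.
pose P (p : {ffun 'I_m -> X} * {ffun 'I_m -> X}) :=
  (#|p.1 @: J| == q) && (h.+1 * s <= #|[set j in ~: J | p.2 j \notin nb (p.1 @: J)]|).
have cardA : #|{ffun 'I_m -> X}| = #|X| ^ m by rewrite card_ffun card_ord.
have cardP : #|[set p | P p]| = #|X| ^ m * #|[set x | deficient x J]|.
  rewrite -cardA -cardsT -cardsX -(card_imset _ (inv_inj swapK)).
  apply: eq_card => p; rewrite -[p in LHS]swapK.
  rewrite (mem_imset _ _ (inv_inj swapK)) !inE /=; case: p => x y.
  rewrite /P /deficient /= mixJ; congr (_ && (_ <= _)); apply: eq_card => j.
  by rewrite !inE ffunE; case: (j \in J).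
have leP : #|[set p | P p]| * tail_lo h ^ s <= #|X| ^ m * (#|X| ^ m * tail_hi h ^ s).
  rewrite -sum1_card (eq_bigl (fun p => P (p.1, p.2))); last by case=> x y; rewrite inE.
  rewrite -(pair_big_dep predT (fun x y => P (x, y)) (fun _ _ => 1)) /=.
  rewrite -[X in _ <= X * _]cardA -sum_nat_const big_distrl /=.
  apply: leq_sum => x _; rewrite sum1_card.
  case: (boolP (#|x @: J| == q)) => cJ; last first.
    by rewrite (_ : #|_| = 0) //; apply: eq_card0.
  apply: leq_trans (card_many_misses s h_gt0 (codeg _ (eqP cJ))).
  rewrite leq_mul2r; apply/orP; right; apply: subset_leq_card; apply/subsetP=> y Py.
  have le_y := Py; rewrite unfold_in /= in le_y; rewrite inE; apply: leq_trans le_y _.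
  by apply: subset_leq_card; apply/subsetP=> j; rewrite !inE => /andP[].
have lo_gt0 : 0 < tail_lo h ^ s by rewrite expn_gt0 (leq_trans _ (tail_ltn h_gt0)).
have n_gt0 : 0 < #|X| ^ m by rewrite expn_gt0 X_gt0.
rewrite cardP -mulnA leq_pmul2l // in leP.
rewrite -(leq_pmul2r lo_gt0); apply: leq_trans (_ : #|X| ^ m * (D * tail_hi h ^ s) <= _).
  by rewrite mulnCA -mulnA leq_mul2l leP orbT.
by rewrite leq_mul2l le_D orbT.
Qed.
End Sampling.

(** Markov's inequality over all q-sets [J]. The threshold counts the q-subsets of [h.+1 * s]
    positions, at least a [1 / 4 ^ q] share of all q-sets, so failure probability [1 / (4 * 4 ^ q)]
    for each [J] suffices. *)
Lemma most_samples_few_deficient q h : 0 < h -> exists s, [/\ 0 < s, q <= s &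
  forall (X : finType) (nb : {set X} -> {set X}), 0 < #|X| ->
    (forall S : {set X}, #|S| = q -> #|X| <= 2 * #|nb S|) ->
    4 * #|[set x | 'C(h.+1 * s, q) <= #|[set J : {set 'I_(2 * h * s)} | (#|J| == q) && deficient nb q x J]| ]|
    <= #|X| ^ (2 * h * s)].
Proof.
move=> h_gt0; have [s [s_gt0 le_qs small]] := tail_small (4 * 4 ^ q) q h_gt0.
exists s; split=> // X nb X_gt0 codeg; set m := 2 * h * s; set Z := [set x | _].
have leC : 'C(m, q) <= 4 ^ q * 'C(h.+1 * s, q) by apply: leq_bin_ratio; rewrite /m; nia.
have C_gt0 : 0 < 'C(h.+1 * s, q) by rewrite bin_gt0; nia.
pose F := [set J : {set 'I_m} | #|J| == q].
have cardF : #|F| = 'C(m, q).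
  rewrite -[X in 'C(X, _)](card_ord m) -cardsT -cards_draws; apply: eq_card => J.
  by rewrite !inE subsetT.
have leZ : #|Z| * 'C(h.+1 * s, q) <= \sum_(J in F) #|[set x in setT | deficient nb q x J]|.
  rewrite -card_set_count -sum_nat_const.
  apply: leq_trans (_ : \sum_(x in Z) #|[set J in F | deficient nb q x J]| <= _).
    apply: leq_sum => x; rewrite inE => /leq_trans; apply.
    by apply: subset_leq_card; apply/subsetP=> J; rewrite !inE.
  by rewrite [X in _ <= X](big_setID Z) /= setTI leq_addr.
have le1 : 4 * 4 ^ q * (\sum_(J in F) #|[set x in setT | deficient nb q x J]|) <= 'C(m, q) * #|X| ^ m.
  rewrite -cardF -sum_nat_const big_distrr /=; apply: leq_sum => J _.
  apply: leq_trans (card_deficient J h_gt0 X_gt0 codeg small).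
  by rewrite leq_mul2l; apply/orP; right; apply: subset_leq_card; apply/subsetP=> x; rewrite !inE.
have {}leZ := leq_trans (leq_mul (leqnn (4 * 4 ^ q)) leZ) le1.
have {}leZ := leq_trans leZ (leq_mul leC (leqnn _)).
have p_gt0 : 0 < 4 ^ q * 'C(h.+1 * s, q) by rewrite muln_gt0 expn_gt0 C_gt0.
rewrite -(leq_pmul2l p_gt0); apply: leq_trans leZ.
by move: (4 ^ q) #|Z| 'C(_, _) => a b c; lia.
Qed.

(** * Touched and common neighbourhoods *)

Section Hypergraph.
Variables (X : finType) (E : {set {set X}}) (q : nat).
Implicit Types (A S I : {set X}).

Definition nb S := [set x | (x \notin S) && (x |: S \in E)].
Definition common A := [set x | [forall S : {set X}, (S \subset A) && (#|S| == q) ==> (x \in nb S)]].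
Definition touched A := [set x | [exists S : {set X}, [&& S \subset A, #|S| == q & x \in nb S]]].
Definition independent I := [forall e in E, ~~ (e \subset I)].

(* The last two clauses are all that is used of the absence of PG_2(q): a
   projective plane is an affine plane together with a line at infinity, and it
   is also a point p together with a transversal design whose groups are the
   lines through p with p removed. *)
Definition plane_free :=
  [/\ forall e, e \in E -> #|e| = q.+1,
      forall S, #|S| = q -> #|X| <= 2 * #|nb S|,
      forall A, q ^ 2 <= #|A| -> independent (common A) &
      forall (J : finType) (e : {set J}) (V : J -> {set X}) (p : X), #|e| = q.+1 ->
        {in e &, forall i j, i != j -> [disjoint V i & V j]} ->
        (forall g : J -> X, {in e, forall i, g i \in V i} -> g @: e \in E) ->
        exists2 i, i \in e & p \notin touched (V i)].

Lemma common_nb A S x : x \in common A -> S \subset A -> #|S| = q -> x \in nb S.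
Proof.
by rewrite inE => /forallP/(_ S)/implyP nbS sSA cS; apply: nbS; rewrite sSA cS eqxx.
Qed.

Lemma nb_touched A S : S \subset A -> #|S| = q -> nb S \subset touched A.
Proof.
by move=> sSA cS; apply/subsetP=> x nbx; rewrite inE; apply/existsP; exists S; rewrite sSA cS eqxx.
Qed.

(** Otherwise some q-subset [S] of [A] would contain [x], but [nb S] never meets [S]. *)
Lemma common_notin A x : 0 < q -> q <= #|A| -> x \in common A -> x \notin A.
Proof.
move=> q_gt0 le_qA comx; apply/negP => Ax.
have [|S sSA cS] := @exists_subset_card X (A :\ x) q.-1.
  by move: (cardsD1 x A); rewrite Ax; lia.
have xS : x \notin S by apply: contraTN sSA => Sx; apply/subsetPn; exists x; rewrite ?inE ?eqxx.
have : x \in nb (x |: S).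
  apply: common_nb comx _ _.
    by rewrite subUset sub1set Ax (subset_trans sSA) // subsetDl.
  by rewrite cardsU1 xS cS; lia.
by rewrite inE setU11.
Qed.

Lemma independent_nb I S x : independent I -> S \subset I -> x \in nb S -> x \notin I.
Proof.
move=> /forallP indI sSI; rewrite inE => /andP[_ Ex]; apply: contraTN (indI (x |: S)) => Ix.
by rewrite Ex /= negbK subUset sub1set Ix.
Qed.

(** The inequality is [#|I| >= (1/2 - 1/h) * #|X|] with denominators cleared. *)
Definition nearly_half h I := independent I /\ h * #|X| <= 2 * h * #|I| + 2 * #|X|.

Lemma nearly_halfW h k I : 0 < k -> nearly_half (k * h) I -> nearly_half h I.
Proof.
by move=> k_gt0 [indI le_I]; split=> //; rewrite -(leq_pmul2l k_gt0); nia.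
Qed.

End Hypergraph.

Arguments nb {X} E S.

(** * Sets that touch little more than half of the vertices *)

Section NearlyHalf.
Variables (q h t : nat).
Hypotheses (q_gt0 : 0 < q) (h_gt0 : 0 < h) (le_qt : q <= t).

(* A box of parts of size t inside which all m-tuples induce the same pattern R
   with no large independent set: the parts touched by a vertex p are
   independent in R. *)
Lemma exists_nearly_half_touched :
  exists n0, forall (X : finType) (E : {set {set X}}), plane_free E q -> n0 <= #|X| ->
    exists2 A : {set X}, #|A| = t & 2 * h * #|touched E q A| <= (h + 2) * #|X|.
Proof.
have [s [s_gt0 le_qs samples]] := most_samples_few_deficient q h_gt0.
set m := 2 * h * s in samples; set K := h.+1 * s in samples.
pose U := #|{: {set {set 'I_m}}}|.
(* At least half of all samples are injective and outside [Z], and the commonest of the [U] possible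
   patterns takes a [1 / U] share of these. *)
have [n0 box] := dense_tuples_contain_box m t (2 * U).
exists (n0 + 4 * m ^ 2 + 1) => X E [unif codeg _ pointed] le_n; set n := #|X| in le_n *.
have {}samples := samples X (nb E) ltac:(lia) codeg.
set Z := [set x | _] in samples.
pose inj := [set x : {ffun 'I_m -> X} | injectiveb x].
have card_inj : #|inj| = n ^_ m by rewrite card_inj_ffuns card_ord.
have le_inj : 3 * n ^ m <= 4 * n ^_ m.
  have := exp_leq_injective n m; have : 3 * n <= 4 * (n - m ^ 2) by lia.
  have n_gt0 : 0 < n by lia.
  move: (n ^ m) (n ^_ m) (n - _) => a b c le1 le2; rewrite -(leq_pmul2r n_gt0); nia.
have le_G0 : n ^ m <= 2 * #|inj :\: Z|.
  have := cardsID Z inj; have : #|inj :&: Z| <= #|Z| by rewrite subset_leq_card // subsetIr.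
  by rewrite card_inj; move: samples; rewrite -/n; lia.
pose pattern (x : {ffun 'I_m -> X}) := [set e : {set 'I_m} | x @: e \in E].
have [R _ le_R] : exists2 R, predT R & n ^ m <= 2 * U * #|[set x in inj :\: Z | pattern x == R]|.
  apply: exists_geq_average; first by exists set0.
  rewrite -big_distrr /= -/U.
  have -> : \sum_R #|[set x in inj :\: Z | pattern x == R]| = #|inj :\: Z|.
    rewrite -[RHS]sum1_card (partition_big pattern predT) //=.
    by apply: eq_bigr => R _; rewrite -sum1_card; apply: eq_bigl => x; rewrite !inE.
  by rewrite mulnC [2 * U]mulnC -mulnA leq_mul2l le_G0 orbT.
set G1 := [set x in _ | _] in le_R.
pose G := [set x : m.-tuple X | [ffun i => tnth x i] \in G1].
have [||V [cV subV]] := box X G; first by lia.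
  apply: leq_trans le_R _; rewrite leq_mul2l; apply/orP; right.
  pose f (x : {ffun 'I_m -> X}) := [tuple x i | i < m].
  have fK : cancel f (fun y => [ffun i => tnth y i]).
    by move=> x; apply/ffunP=> i; rewrite ffunE tnth_mktuple.
  rewrite -(card_imset _ (can_inj fK)); apply: subset_leq_card.
  by apply/subsetP=> _ /imsetP[x Gx ->]; rewrite inE fK.
have {G subV}subV (g : 'I_m -> X) : (forall i, g i \in V i) -> [ffun i => g i] \in G1.
  move=> Vg; have : [tuple g i | i < m] \in G by apply: subV => i; rewrite tnth_mktuple.
  by rewrite inE (_ : [ffun i => _] = [ffun i => g i]) //; apply/ffunP=> i; rewrite !ffunE tnth_mktuple.
have [v0 Vv0] : exists v0 : 'I_m -> X, forall i, v0 i \in V i.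
  have V0 i : exists v, v \in V i by apply/card_gt0P; rewrite cV; lia.
  by exists (fun i => xchoose (V0 i)) => i; apply: xchooseP.
(* A vertex common to two parts could be chosen twice, giving a member of [G1] that is not
   injective. *)
have disjV i j : i != j -> [disjoint V i & V j].
  move=> neq_ij; rewrite -setI_eq0; apply/set0Pn => -[v /setIP[Vi Vj]].
  pose g k := if (k == i) || (k == j) then v else v0 k.
  have /subV : forall k, g k \in V k.
    by move=> k; rewrite /g; case: eqP => [->|_] //=; case: eqP => [->|].
  rewrite !inE => /andP[/andP[_ /injectiveP inj_g] _].
  by case/eqP: neq_ij; apply: inj_g; rewrite !ffunE /g !eqxx orbT.
(* All transversals have pattern [R], so one of them decides for all whether the image of [e] is an
   edge. *)
have transV (e : {set 'I_m}) (g : 'I_m -> X) : [ffun i => v0 i] @: e \in E ->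
    {in e, forall i, g i \in V i} -> g @: e \in E.
  move=> Ee Vg; pose g' i := if i \in e then g i else v0 i.
  have -> : g @: e = [ffun i => g' i] @: e.
    by apply: eq_in_imset => i ei; rewrite ffunE /g' ei.
  have pat x : x \in G1 -> (x @: e \in E) = (e \in R).
    by rewrite inE => /andP[_ /eqP <-]; rewrite inE.
  rewrite pat; last by apply: subV => i; rewrite /g'; case: ifP => // ei; apply: Vg.
  by rewrite -(pat _ (subV _ Vv0)).
pose I p := [set i | p \in touched E q (V i)].
(* Otherwise every q-subset [J] of [I p] is deficient for the sample [x]: for [j] in [I p] outside
   [J], an edge on [j |: J] would make all its transversals edges, while [p] touches all these
   parts, against [pointed]. That is too many deficient sets for a sample outside [Z]. *)
have leI p : #|I p| <= K + q.
  rewrite leqNgt; apply/negP => lt_I; have := subV _ Vv0; set x := [ffun i => v0 i].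
  rewrite inE => /andP[/setDP[inj_x notZ] _]; case/negP: notZ; rewrite inE.
  rewrite inE in inj_x; move/injectiveP: inj_x => inj_x.
  apply: leq_trans (_ : 'C(#|I p|, q) <= _); first by apply: leq_bin2l; lia.
  rewrite -cards_draws; apply: subset_leq_card; apply/subsetP=> J.
  rewrite !inE => /andP[sJI cJ]; rewrite cJ /= /deficient card_imset // cJ /=.
  have leK : K <= #|I p :\: J| by move: (cardsD (I p) J); rewrite (setIidPr sJI) (eqP cJ); lia.
  apply: leq_trans leK _; apply: subset_leq_card; apply/subsetP=> j /setDP[Ij nJj].
  rewrite inE in_setC nJj /=; apply/negP; rewrite inE -imsetU1 => /andP[_ Ee].
  have [|||i] := pointed _ (j |: J) V p.
  - by rewrite cardsU1 nJj (eqP cJ).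
  - by move=> i k _ _; apply: disjV.
  - by move=> g Vg; apply: transV.
  rewrite !inE => /predU1P[->|Ji]; first by case/negP; have := Ij; rewrite !inE.
  by case/negP; have := subsetP sJI i Ji; rewrite !inE.
(* An average part is touched by at most a [(K + q) / m] share of the vertices, and [q <= s] bounds
   this by [(h + 2) / (2 * h)]. *)
have [i _ le_i] : exists2 i, predT i & 2 * h * #|touched E q (V i)| <= (h + 2) * n.
  apply: exists_leq_average; first by exists (Ordinal (ltac:(rewrite /m; nia) : 0 < m)).
  rewrite -big_distrr /= card_ord.
  apply: leq_trans (_ : 2 * h * (n * (K + q)) <= _); last first.
    have : K + q <= (h + 2) * s by rewrite /K; nia.
    by rewrite /m; move: (K + q) => u leu; nia.
  rewrite leq_mul2l; apply/orP; right.
  rewrite (eq_bigr (fun i => #|[set p | p \in touched E q (V i)]|)); last first.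
    by move=> i _; apply: eq_card => p; rewrite [in RHS]inE.
  by rewrite card_rel_count -sum_nat_const; apply: leq_sum => p _; apply: leI.
by exists (V i).
Qed.

End NearlyHalf.

(** * From nearly half to exactly half *)

(** Union bound: a random s-subset of [N] points meets a fixed set of [b] points with probability at
    most [b * s / N]. *)
Lemma bin_sub_leq N b s : N * 'C(N, s) <= N * 'C(N - b, s) + b * s * 'C(N, s).
Proof.
case: s => [|s]; first by rewrite !bin0; lia.
elim: b => [|b IH]; first by rewrite subn0; lia.
apply: leq_trans IH _; have [le_Nb|lt_bN] := leqP N b.
  have -> : N - b = 0 by lia.
  have -> : N - b.+1 = 0 by lia.
  by rewrite !bin0n muln0; nia.
rewrite (_ : N - b = (N - b.+1).+1) ?binS; last by lia.
have : N * 'C(N.-1, s) = s.+1 * 'C(N, s.+1) by rewrite mul_bin_diag.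
have : 'C(N - b.+1, s) <= 'C(N.-1, s) by apply: leq_bin2l; lia.
by move: 'C(N - b.+1, s) 'C(N.-1, s) 'C(N, s.+1) 'C(_, _) => c1 c2 c3 c4; nia.
Qed.

Lemma card_draws_outside (X : finType) (Y G : {set X}) s :
  #|Y| * #|[set T : {set X} | [&& T \subset Y, #|T| == s & ~~ (T \subset G)]]|
  <= #|Y :\: G| * s * 'C(#|Y|, s).
Proof.
set Z := [set T | _].
have : #|Z| + 'C(#|Y :&: G|, s) = 'C(#|Y|, s).
  rewrite -!cards_draws -(cardsID [set T : {set X} | T \subset G] [set T : {set X} | T \subset Y & #|T| == s]).
  rewrite addnC; congr (_ + _); apply: eq_card => T; rewrite !inE ?subsetI.
    by case: (T \subset Y); case: (T \subset G); rewrite ?andbF ?andbT.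
  by case: (T \subset Y); case: (T \subset G); rewrite ?andbF ?andbT.
have := bin_sub_leq #|Y| #|Y :\: G| s.
rewrite (_ : #|Y| - _ = #|Y :&: G|); last by have := cardsID G Y; lia.
by move: 'C(_, _) 'C(_, _) => c1 c2; nia.
Qed.

Lemma exists_split (X : finType) (t k : nat) (T : {set X}) : #|T| = k * t ->
  exists V : 'I_k -> {set X}, [/\ forall i, V i \subset T, forall i, #|V i| = t &
    forall i j, i != j -> [disjoint V i & V j]].
Proof.
elim: k T => [|k IH] T cT; first by exists (fun=> set0); split=> [[]|[]|[]].
have [|A sAT cA] := @exists_subset_card X T t; first by lia.
have [|V [sV cV dV]] := IH (T :\: A).
  by rewrite cardsD (setIidPr sAT); lia.
have dA j : [disjoint A & V j].
  rewrite disjoint_sym disjoints_subset; apply: subset_trans (sV j) _.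
  by apply/subsetP=> x /setDP[_]; rewrite inE.
exists (fun i => if unlift ord0 i is Some j then V j else A); split=> [i|i|i j].
- by case: unliftP => [j _|_] //; apply: subset_trans (sV j) (subsetDl _ _).
- by case: unliftP.
case: unliftP => [i' ->|->]; case: unliftP => [j' ->|->]; rewrite ?eqxx //.
- by rewrite (inj_eq lift_inj) => /dV.
by rewrite disjoint_sym.
Qed.

Section PlaneFree.
Variables (X : finType) (E : {set {set X}}) (q : nat).
Hypotheses (q_gt0 : 0 < q) (free : plane_free E q).
Implicit Types (A S I T : {set X}).
Local Notation n := #|X|.
Local Notation nb := (nb E).
Local Notation common := (common E q).
Local Notation nearly_half := (nearly_half E).
Local Notation touched := (touched E q).

Let codeg S : #|S| = q -> n <= 2 * #|nb S|. Proof. by case: free => _ + _ _; apply. Qed.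

Let common_independent A : q ^ 2 <= #|A| -> independent E (common A).
Proof. by case: free => _ _ + _; apply. Qed.

(** The neighbourhood of a q-subset of [I] contains at least half of the vertices and avoids [I]. *)
Lemma leq_independent I : independent E I -> q <= #|I| -> 2 * #|I| <= n.
Proof.
move=> indI /exists_subset_card[S sSI cS]; have := codeg cS; rewrite -(cardsC I).
have : #|nb S| <= #|~: I|; last by lia.
by apply/subset_leq_card/subsetP=> x nbx; rewrite inE (independent_nb indI sSI).
Qed.

(** Union bound over the q-subsets of [A]: a point outside [common A] is missed by one of their
    neighbourhoods. *)
Lemma common_misses h A (Y : {set X}) :
  (forall S, S \subset A -> #|S| = q -> h * #|Y :\: nb S| <= n) ->
  h * #|Y :\: common A| <= 'C(#|A|, q) * n.
Proof.
move=> miss; pose D := [set S : {set X} | S \subset A & #|S| == q].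
have sub : #|Y :\: common A| <= \sum_(S in D) #|[set x in Y | x \notin nb S]|.
  rewrite card_set_count.
  apply: leq_trans (_ : \sum_(x in Y :\: common A) 1 <= _); first by rewrite sum1_card.
  rewrite [X in _ <= X](big_setID (~: common A)) /= -setDE; apply: leq_trans (leq_addr _ _).
  apply: leq_sum => x /setDP[_]; rewrite inE negb_forall => /existsP[S].
  rewrite negb_imply => /andP[DS nbS].
  by apply/card_gt0P; exists S; rewrite !inE DS; rewrite inE in nbS.
apply: leq_trans (leq_mul (leqnn h) sub) _.
rewrite big_distrr /= -cards_draws -sum_nat_const; apply: leq_sum => S.
rewrite inE => /andP[sSA /eqP cS]; apply: leq_trans (miss S sSA cS).
rewrite leq_mul2l; apply/orP; right; apply/subset_leq_card/subsetP=> x.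
by rewrite inE => /andP[Yx nbx]; apply/setDP.
Qed.

(** Write [C] for the binomial coefficient. Each [nb S] has at least [n / 2] points and lies in
    [touched A], which has at most [n / 2 + n / (C * h)]. So each misses at most [n / (C * h)] of
    it, and all [C] together miss at most [n / h]. *)
Lemma nearly_half_of_touched h A : q ^ 2 <= #|A| ->
  2 * ('C(#|A|, q) * h) * #|touched A| <= ('C(#|A|, q) * h + 2) * n ->
  nearly_half h (common A).
Proof.
move=> le_A; set C := 'C(_, _) => le_t; split; first exact: common_independent.
have le_qA : q <= #|A| by nia.
have C_gt0 : 0 < C by rewrite bin_gt0.
have [S sSA cS] := exists_subset_card le_qA.
have sub : common A \subset touched A.
  by apply/subsetP=> x /common_nb/(_ sSA cS); apply: (subsetP (nb_touched E sSA cS)).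
have le_nt : n <= 2 * #|touched A|.
  by apply: leq_trans (codeg cS) _; rewrite leq_mul2l subset_leq_card ?nb_touched.
have : C * h * #|touched A :\: common A| <= C * n.
  apply: common_misses => S' sS' cS'; have := codeg cS'.
  rewrite cardsD (setIidPr (nb_touched E sS' cS')).
  have : #|nb S'| <= #|touched A| by rewrite subset_leq_card ?nb_touched.
  by move: (C * h) le_t => c; nia.
rewrite -mulnA leq_pmul2l // cardsD (setIidPr sub).
have := subset_leq_card sub.
by move: #|common A| #|touched A| le_nt => a b; nia.
Qed.

(** The same count inside [~: I], which contains every [nb S] by independence and exceeds [n / 2]
    only slightly. *)
Lemma nearly_half_common_misses h I A : nearly_half ('C(#|A|, q) * h) I ->
  A \subset I -> q <= #|A| -> h * #|~: I :\: common A| <= n.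
Proof.
move=> [indI +] sAI le_qA; have : 0 < 'C(#|A|, q) by rewrite bin_gt0.
set C := 'C(_, _) => C_gt0 le_I; rewrite -(leq_pmul2l C_gt0) mulnA.
apply: common_misses => S sSA cS; have := codeg cS.
have sub : nb S \subset ~: I.
  by apply/subsetP=> x nbx; rewrite inE (independent_nb indI (subset_trans sSA sAI)).
rewrite cardsD (setIidPr sub); have := subset_leq_card sub; have := cardsC I.
by move: #|~: I| #|nb S| (C * h) le_I => a b c; nia.
Qed.

Lemma common_sub_setC I A : independent E I -> A \subset I -> q <= #|A| -> common A \subset ~: I.
Proof.
move=> indI sAI /exists_subset_card[S sSA cS]; apply/subsetP=> x /common_nb/(_ sSA cS) nbx.
by rewrite inE (independent_nb indI (subset_trans sSA sAI)).
Qed.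

(** By independence of [I], the set [~: I] has at least [n / 2] points, and [common A] misses at
    most [n / h] of them. *)
Lemma nearly_half_common h I A : nearly_half ('C(#|A|, q) * h) I ->
  A \subset I -> q ^ 2 <= #|A| -> nearly_half h (common A).
Proof.
move=> nearI sAI le_A; split; first exact: common_independent.
have le_qA : q <= #|A| by nia.
have := nearly_half_common_misses nearI sAI le_qA; have sub := common_sub_setC nearI.1 sAI le_qA.
rewrite cardsD (setIidPr sub); have := subset_leq_card sub; have := cardsC I.
have := leq_independent nearI.1 (leq_trans le_qA (subset_leq_card sAI)).
by move: #|common A| #|~: I| #|I| => a b c; nia.
Qed.

(** Draw [T] from [I] and [T'] from [I'] at random: each of the two inclusions fails for at most a
    quarter of the pairs. *)
Lemma exists_cross_pair s I I' : q <= s -> s <= #|I| -> s <= #|I'| -> I' \subset ~: I ->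
  nearly_half ('C(s, q) * (16 * s)) I -> nearly_half ('C(s, q) * (16 * s)) I' ->
  exists T T', [/\ #|T| = s, #|T'| = s, T' \subset common T & T \subset common T'].
Proof.
move=> le_qs le_sI le_sI' sII' nearI nearI'.
(* [common T] misses at most [n / (16 * s)] points of [Z], hence at most [#|Z| / (4 * s)]; the union
   bound over the [s] points of [T'] leaves a quarter. *)
have bad (Y Z T : {set X}) : Z \subset ~: Y -> nearly_half ('C(s, q) * (16 * s)) Y ->
    nearly_half ('C(s, q) * (16 * s)) Z -> s <= #|Z| -> T \subset Y -> #|T| == s ->
    4 * #|[set T' : {set X} | [&& T' \subset Z, #|T'| == s & ~~ (T' \subset common T)]]| <= 'C(#|Z|, s).
  move=> sZY nearY nearZ le_sZ sTY /eqP cT.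
  have le_n : n <= 4 * #|Z|.
    have [_] : nearly_half (16 * s) Z by apply: nearly_halfW nearZ; rewrite bin_gt0.
    by nia.
  have := card_draws_outside Z (common T) s.
  have : 16 * s * #|Z :\: common T| <= n.
    apply: leq_trans (_ : 16 * s * #|~: Y :\: common T| <= _).
      by rewrite leq_mul2l subset_leq_card ?orbT // setSD.
    by apply: nearly_half_common_misses; rewrite ?cT.
  have Z_gt0 : 0 < #|Z| by lia.
  move: #|[set _ | _]| #|Z :\: _| 'C(_, _) => a b c le1 le2.
  by rewrite -(leq_pmul2l Z_gt0); nia.
pose D := [set T : {set X} | T \subset I & #|T| == s].
pose D' := [set T : {set X} | T \subset I' & #|T| == s].
have D_gt0 : 0 < #|D| by rewrite cards_draws bin_gt0.
have D'_gt0 : 0 < #|D'| by rewrite cards_draws bin_gt0.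
have [[T T'] /=|none] := pickP (fun p : {set X} * {set X} => [&& p.1 \in D, p.2 \in D',
  p.2 \subset common p.1 & p.1 \subset common p.2]).
  rewrite !inE => /and4P[/andP[_ /eqP cT] /andP[_ /eqP cT'] s1 s2].
  by exists T, T'.
have : \sum_(T in D) \sum_(T' in D') 1 <=
    \sum_(T in D) #|[set T' in D' | ~~ (T' \subset common T)]|
    + \sum_(T' in D') #|[set T in D | ~~ (T \subset common T')]|.
  rewrite -(card_set_count D D' (fun T T' => ~~ (T \subset common T'))) -big_split /=.
  apply: leq_sum => T DT; rewrite sum1_card -cardsUI; apply: leq_trans (leq_addr _ _).
  apply/subset_leq_card/subsetP=> T' DT'; rewrite in_setU [_ \in finset _]inE [X in _ || X]inE DT' /=.
  by have := none (T, T'); rewrite /= DT DT' /= -negb_and => ->.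
have le1 : 4 * \sum_(T in D) #|[set T' in D' | ~~ (T' \subset common T)]| <= #|D| * #|D'|.
  rewrite big_distrr /= -sum_nat_const; apply: leq_sum => T; rewrite inE => /andP[sT cT].
  rewrite cards_draws; apply: leq_trans (bad _ _ _ sII' nearI nearI' le_sI' sT cT).
  rewrite leq_mul2l; apply/orP; right; apply/subset_leq_card/subsetP=> T'.
  by rewrite !inE -andbA.
have le2 : 4 * \sum_(T' in D') #|[set T in D | ~~ (T \subset common T')]| <= #|D| * #|D'|.
  rewrite big_distrr /= mulnC -sum_nat_const; apply: leq_sum => T; rewrite inE => /andP[sT cT].
  rewrite cards_draws; apply: leq_trans (bad _ _ _ _ nearI' nearI le_sI sT cT).
    rewrite leq_mul2l; apply/orP; right; apply/subset_leq_card/subsetP=> T'.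
    by rewrite !inE -andbA.
  by rewrite -setCS setCK.
rewrite sum_nat_const sum1_card; have := muln_gt0 #|D| #|D'|; rewrite D_gt0 D'_gt0.
by move: (#|D| * #|D'|) le1 le2 => d le1 le2; lia.
Qed.

(* Otherwise p would be the missing point of a projective plane with groups in
   the V i, for i in a, and in B. *)
Lemma cross_touched (J : finType) (V : J -> {set X}) (a : {set J}) T (B : {set X}) p :
  q <= #|T| -> (forall i, V i \subset T) -> (forall i j, i != j -> [disjoint V i & V j]) ->
  B \subset common T -> #|a| = q -> {in a, forall i, p \in touched (V i)} -> p \notin touched B.
Proof.
move=> le_qT sVT dV sB ca Va; case: free => _ _ _.
have dBV i : [disjoint B & V i].
  rewrite disjoints_subset; apply/subsetP=> x /(subsetP sB)/(common_notin q_gt0 le_qT).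
  by rewrite inE; apply: contra; apply: (subsetP (sVT i)).
(* [None] indexes the extra part [B], beside the [q] parts indexed by [a]. *)
pose V' (o : option J) := if o is Some i then V i else B.
have NSome : None \notin Some @: a by apply/imsetP => -[].
move=> /(_ _ (None |: Some @: a) V' p) [||g Vg|].
- by rewrite cardsU1 NSome card_imset ?ca // => i j [].
- move=> [i|] [j|] _ _ //=; first by rewrite (inj_eq Some_inj) => /dV.
  by rewrite disjoint_sym.
- rewrite imsetU1 -imset_comp; set S := _ @: a.
  have gV i : i \in a -> g (Some i) \in V i.
    by move=> ai; apply: (Vg (Some i)); rewrite !inE imset_f.
  (* The points chosen in the [V i] form a q-subset of [T], and the point chosen in [B] lies in
     [common T], so it completes them to an edge. *)
  have : g None \in nb S.
    apply: common_nb (subsetP sB _ (Vg None _)) _ _; first by rewrite !inE.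
      by apply/subsetP=> _ /imsetP[i ai ->]; apply: (subsetP (sVT i)); apply: gV.
    rewrite card_in_imset // => i j ai aj /= eq_g; apply/eqP; apply: contraT => /dV.
    by rewrite disjoint_subset => /subsetP/(_ _ (gV i ai)); rewrite inE eq_g gV.
  by rewrite inE => /andP[].
by move=> o /setU1P[->|/imsetP[i ai ->]] //=; rewrite Va.
Qed.

(** A vertex touching [q] parts on one side touches none on the other; as [2 * q <= k], it touches
    at most [k] of the [2 * k] parts in every case. Averaging gives a pair [V i], [V' i] whose
    touched sets have total size at most [n], and the smaller one serves. *)
Lemma exists_half_touched t k T T' : q <= t -> 2 * q <= k -> #|T| = k * t -> #|T'| = k * t ->
  T' \subset common T -> T \subset common T' ->
  exists2 A : {set X}, #|A| = t & 2 * #|touched A| <= n.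
Proof.
move=> le_qt le_qk cT cT' sT' sT.
have le_qT : q <= #|T| by nia.
have le_qT' : q <= #|T'| by nia.
have [V [sV cV dV]] := exists_split cT; have [V' [sV' cV' dV']] := exists_split cT'.
pose a p := #|[set i | p \in touched (V i)]|; pose a' p := #|[set i | p \in touched (V' i)]|.
have le_k p : a p + a' p <= k.
  have le_a : a p <= k by rewrite -[k in X in _ <= X]card_ord max_card.
  have le_a' : a' p <= k by rewrite -[k in X in _ <= X]card_ord max_card.
  have none : q <= a p -> a' p = 0.
    move=> /exists_subset_card[b sb cb]; apply: eq_card0 => i; rewrite inE; apply/negbTE.
    apply: (cross_touched le_qT sV dV (subset_trans (sV' i) sT') cb) => j bj.
    by have := subsetP sb j bj; rewrite inE.
  have none' : q <= a' p -> a p = 0.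
    move=> /exists_subset_card[b sb cb]; apply: eq_card0 => i; rewrite inE; apply/negbTE.
    apply: (cross_touched le_qT' sV' dV' (subset_trans (sV i) sT) cb) => j bj.
    by have := subsetP sb j bj; rewrite inE.
  by case: (leqP q (a p)); case: (leqP q (a' p)); lia.
have sum_touched (W : 'I_k -> {set X}) :
    \sum_i #|touched (W i)| = \sum_(p : X) #|[set i | p \in touched (W i)]|.
  rewrite -card_rel_count; apply: eq_bigr => i _.
  by apply: eq_card => p; rewrite [in RHS]inE.
have [i _ le_i] : exists2 i : 'I_k, predT i & 2 * #|touched (V i)| + 2 * #|touched (V' i)| <= 2 * n.
  apply: exists_leq_average; first by exists (Ordinal (ltac:(lia) : 0 < k)).
  rewrite big_split /= -!big_distrr /= !sum_touched -mulnDr -big_split card_ord -mulnA leq_mul2l /=.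
  rewrite -sum_nat_const; apply: leq_sum => p _; exact: le_k.
case: (leqP (2 * #|touched (V i)|) n) => [|lt_n]; first by exists (V i).
by exists (V' i) => //; lia.
Qed.

Lemma bipartition_of_half_touched A : q ^ 2 <= #|A| -> 2 * #|A| <= n -> 2 * #|touched A| <= n ->
  exists2 X0 : {set X}, 2 * #|X0| = n & independent E X0 /\ independent E (~: X0).
Proof.
move=> le_A le_An le_t; have le_qA : q <= #|A| by nia.
have [S0 sS0 cS0] := exists_subset_card le_qA.
(* Used for [A] with [touched A], then for a subset of [touched A] with the complement. Sizes force
   [nb S = Y] for every [S]. *)
have half (B Y : {set X}) : q ^ 2 <= #|B| -> 2 * #|Y| <= n ->
    (forall S, S \subset B -> #|S| = q -> nb S \subset Y) -> independent E Y.
  move=> le_B le_Y nbY; suff <- : common B = Y by apply: common_independent.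
  have nbE S : S \subset B -> #|S| = q -> nb S = Y.
    move=> sSB cS; apply/eqP; rewrite eqEcard nbY //=; have := codeg cS; lia.
  have [|S sSB cS] := @exists_subset_card X B q; first by nia.
  apply/eqP; rewrite eqEsubset; apply/andP; split; apply/subsetP=> x.
    by move/common_nb/(_ sSB cS); rewrite nbE.
  move=> Yx; rewrite inE; apply/forallP=> S'; apply/implyP=> /andP[sS' /eqP cS'].
  by rewrite nbE.
have indX1 : independent E (touched A) by apply: (half A) => // S sSA cS; apply: nb_touched.
have cX1 : 2 * #|touched A| = n.
  apply/eqP; rewrite eqn_leq le_t; apply: leq_trans (codeg cS0) _.
  by rewrite leq_mul2l subset_leq_card ?nb_touched.
exists (touched A) => //; split=> //.
(* Room for [B] comes from [2 * #|A| <= n], as [touched A] has exactly [n / 2] vertices. *)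
have [|B sB cB] := @exists_subset_card X (touched A) #|A|; first by lia.
apply: (half B); rewrite ?cB //; first by have := cardsC (touched A); lia.
move=> S sSB cS; apply/subsetP=> x nbx.
by rewrite inE (independent_nb indX1 (subset_trans sSB sB)).
Qed.

End PlaneFree.

(** * Choice of constants and assembly of the partition *)

Theorem plane_free_bipartition q : 0 < q ->
  exists n0, forall (X : finType) (E : {set {set X}}), plane_free E q -> n0 <= #|X| ->
    exists2 X0 : {set X}, 2 * #|X0| = #|X| & independent E X0 /\ independent E (~: X0).
Proof.
(* Parts have size [t], and [s] makes room for [2 * q] of them on each side; [h] is the precision
   needed for the cross pair. Each of the two passages to a common neighbourhood costs a factor
   [Ct]. *)
move=> q_gt0; pose t := q ^ 2; have le_qt : q <= t by rewrite /t; nia.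
pose s := 2 * q * t; pose h := 'C(s, q) * (16 * s); pose Ct := 'C(t, q).
have Ct_gt0 : 0 < Ct by rewrite bin_gt0.
have s_gt0 : q <= s by rewrite /s; nia.
have h_gt0 : 0 < h by rewrite /h !muln_gt0 bin_gt0; nia.
have [|n0 near] := @exists_nearly_half_touched q (Ct * (Ct * h)) t q_gt0 _ le_qt.
  by rewrite muln_gt0 Ct_gt0 muln_gt0 Ct_gt0.
exists (n0 + 4 * s + 4 * t) => X E free le_n.
have [|A cA le_A] := near X E free; first by lia.
have nearI : nearly_half E (Ct * h) (common E q A).
  by apply: (nearly_half_of_touched q_gt0 free); rewrite ?cA.
have large I : nearly_half E h I -> #|X| <= 4 * #|I|.
  case=> _; have : 4 <= h by rewrite /h; have : 0 < 'C(s, q) by [rewrite bin_gt0]; nia.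
  by nia.
have nearI1 : nearly_half E h (common E q A) := nearly_halfW Ct_gt0 nearI.
have le1 := large _ nearI1.
have [|B sB cB] := @exists_subset_card X (common E q A) t; first by lia.
have nearI2 : nearly_half E h (common E q B).
  by apply: (nearly_half_common q_gt0 free _ sB); rewrite cB.
have le2 := large _ nearI2.
have [|||T [T' [cT cT' sT' sT]]] := exists_cross_pair q_gt0 free s_gt0 _ _ _ nearI1 nearI2.
- by lia.
- by lia.
- by apply: common_sub_setC nearI.1 sB _; rewrite cB.
have [B' cB' le_B'] := exists_half_touched q_gt0 free le_qt (leqnn _) cT cT' sT' sT.
by apply: (bipartition_of_half_touched q_gt0 free (A := B')); rewrite ?cB' //; lia.
Qed.

(** * Embedding projective planes *)

Section Matching.
Variables (T X : finType) (x0 : X) (A : {set T}) (B : {set X}).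
Hypothesis le_AB : #|A| <= #|B|.

(** An injection of [A] into [B] that pairs their enumerations position by position, with [x0] as
    the default of [nth]. *)
Definition matching (x : T) := nth x0 (enum B) (index x (enum A)).

Let index_ltn x : x \in A -> index x (enum A) < size (enum B).
Proof. by move=> Ax; rewrite -cardE (leq_trans _ le_AB) // cardE index_mem mem_enum. Qed.

Lemma matching_in x : x \in A -> matching x \in B.
Proof. by move=> Ax; rewrite -mem_enum mem_nth ?index_ltn. Qed.

Lemma matching_inj : {in A &, injective matching}.
Proof.
move=> x y Ax Ay /eqP; rewrite nth_uniq ?index_ltn ?enum_uniq // => /eqP eq_i.
by rewrite -(nth_index x (_ : x \in enum A)) ?mem_enum // eq_i nth_index ?mem_enum.
Qed.
End Matching.

Section ProjectivePlane.
Variables (T : finType) (q : nat) (Pts : {set T}) (Lines : {set {set T}}).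

Definition projective_plane :=
  [/\ #|Pts| = q ^ 2 + q + 1,
      forall L, L \in Lines -> L \subset Pts /\ #|L| = q.+1,
      {in Pts &, forall x y, x != y -> exists L, [/\ L \in Lines, x \in L & y \in L]} &
      {in Lines &, forall L M, L != M -> #|L :&: M| = 1}].

Hypotheses (q_gt0 : 0 < q) (plane : projective_plane).

Let sub_pts L : L \in Lines -> L \subset Pts. Proof. by case: plane => _ + _ _ => /[apply] -[]. Qed.
Let card_line L : L \in Lines -> #|L| = q.+1. Proof. by case: plane => _ + _ _ => /[apply] -[]. Qed.

Let line_uniq L M x y : L \in Lines -> M \in Lines -> x != y ->
  x \in L -> y \in L -> x \in M -> y \in M -> L = M.
Proof.
case: plane => _ _ _ meet LL LM neq_xy Lx Ly Mx My; apply/eqP; apply: contraT => /(meet _ _ LL LM) /eqP.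
case/cards1P=> z eq_z; have := in_set1 x z; have := in_set1 y z.
rewrite -eq_z !inE Lx Ly Mx My /= => /esym/eqP eqy /esym/eqP eqx.
by rewrite eqx eqy eqxx in neq_xy.
Qed.

Variables (X : finType) (E : {set {set X}}).

Definition embeds := exists f : T -> X,
  {in Pts &, injective f} /\ forall L, L \in Lines -> f @: L \in E.

(** A line [L0] goes onto [e] and the [q ^ 2] points off it go into [A]. Any other line has one
    point on [L0] and [q] points off it, so its image is an edge by hypothesis. *)
Lemma embeds_affine (e A : {set X}) : e \in E -> #|e| = q.+1 -> q ^ 2 <= #|A| -> [disjoint A & e] ->
  (forall x (S : {set X}), x \in e -> S \subset A -> #|S| = q -> x |: S \in E) -> embeds.
Proof.
move=> Ee ce leA dAe AE.
have [x0 ex0] : exists x0, x0 \in e by apply/card_gt0P; rewrite ce.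
have [L0 LL0] : exists L0, L0 \in Lines.
  case: plane => cP _ thru _; have /card_gt1P[x [y [Px Py neq_xy]]] : 1 < #|Pts| by rewrite cP; nia.
  by have [L [LL _ _]] := thru x y Px Py neq_xy; exists L.
have le_e : #|L0| <= #|e| by rewrite ce card_line.
have le_A : #|Pts :\: L0| <= #|A|.
  apply: leq_trans leA; rewrite cardsD (setIidPr (sub_pts LL0)) (card_line LL0).
  by case: plane => -> _ _ _; lia.
pose f x := if x \in L0 then matching x0 L0 e x else matching x0 (Pts :\: L0) A x.
have fe x : x \in L0 -> f x \in e by move=> Lx; rewrite /f Lx matching_in.
have fA x : x \in Pts -> x \notin L0 -> f x \in A.
  by move=> Px nLx; rewrite /f (negPf nLx) matching_in // inE nLx.
have dis u v : u \in A -> v \in e -> u <> v.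
  by move=> Au ev uv; move: dAe; rewrite disjoint_subset => /subsetP/(_ u Au); rewrite inE uv ev.
have inj_f : {in Pts &, injective f}.
  move=> x y Px Py; case: (boolP (x \in L0)) => Lx; case: (boolP (y \in L0)) => Ly.
  - by rewrite /f Lx Ly; apply: matching_inj.
  - by move/esym/dis => []; [apply: fA | apply: fe].
  - by move/dis => []; [apply: fA | apply: fe].
  by rewrite /f (negPf Lx) (negPf Ly); apply: matching_inj; rewrite // inE ?Lx ?Ly.
exists f; split=> // L LL; have [->|neqL] := eqVneq L L0.
  rewrite (_ : f @: L0 = e) //; apply/eqP; rewrite eqEcard; apply/andP; split.
    by apply/subsetP=> _ /imsetP[x Lx ->]; apply: fe.
  rewrite ce card_in_imset ?card_line // => x y Lx Ly.
  by apply: inj_f; apply: (subsetP (sub_pts LL0)).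
have /eqP/cards1P[z eq_z] : #|L :&: L0| = 1 by case: plane => _ _ _; apply.
have /setIP[Lz L0z] : z \in L :&: L0 by rewrite eq_z set11.
rewrite -(setD1K Lz) imsetU1; apply: AE; first exact: fe.
  apply/subsetP=> _ /imsetP[x /setD1P[neq_xz Lx] ->]; apply: fA; first exact: (subsetP (sub_pts LL)).
  by apply: contra neq_xz => L0x; rewrite -in_set1 -eq_z inE Lx.
have cLz : #|L :\ z| = q by have := cardsD1 z L; rewrite Lz card_line //; lia.
rewrite card_in_imset => [//|x y /setD1P[_ Lx] /setD1P[_ Ly]].
by apply: inj_f; apply: (subsetP (sub_pts LL)).
Qed.

(** A point [P0] goes to [p], and the [q + 1] lines through it, with [P0] removed, go onto the sets
    [S i]. A line that avoids [P0] meets each of these lines once, so its image is a transversal. *)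
Lemma embeds_pointed (J : finType) (e : {set J}) (S : J -> {set X}) (p : X) : #|e| = q.+1 ->
  {in e, forall i, [/\ #|S i| = q, p \notin S i & p |: S i \in E]} ->
  {in e &, forall i j, i != j -> [disjoint S i & S j]} ->
  (forall g : J -> X, {in e, forall i, g i \in S i} -> g @: e \in E) -> embeds.
Proof.
move=> ce Sp dS transE.
have [j0 _] : exists j0, j0 \in e by apply/card_gt0P; rewrite ce.
have [P0 PP0] : exists P0, P0 \in Pts.
  by apply/card_gt0P; case: plane => -> _ _ _; lia.
pose pencil := [set L in Lines | P0 \in L].
pose line x := odflt set0 [pick L in pencil | x \in L].
have lineP x : x \in Pts -> x != P0 -> [/\ line x \in Lines, P0 \in line x & x \in line x].
  move=> Px neq_x; rewrite /line; case: pickP => [L /andP[]|none] /=.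
    by rewrite inE => /andP[].
  case: plane => _ _ /(_ x P0 Px PP0 neq_x)[L [LL Lx L0]] _.
  by have := none L; rewrite inE LL Lx L0.
have lineE L x : L \in Lines -> P0 \in L -> x \in L -> x != P0 -> line x = L.
  move=> LL L0 Lx neq_x; have [Lx' L0' xLx] := lineP x (subsetP (sub_pts LL) x Lx) neq_x.
  exact: line_uniq Lx' LL neq_x _ _ _ _.
(* The lines through [P0] split the other [q ^ 2 + q] points into classes of size [q]. *)
have card_pencil : #|pencil| = q.+1.
  have : #|Pts :\ P0| = #|pencil| * q.
    rewrite -sum1_card (partition_big line (mem pencil)) /=; last first.
      by move=> x /setD1P[neq_x Px]; have [Lx L0 _] := lineP x Px neq_x; rewrite inE Lx.
    rewrite -sum_nat_const; apply: eq_bigr => L; rewrite inE => /andP[LL L0].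
    have := cardsD1 P0 L; rewrite L0 card_line // add1n => -[->].
    rewrite sum1_card; apply: eq_card => x; rewrite unfold_in !inE -andbA.
    case: (boolP (x == P0)) => //= neq_x; apply/andP/idP => [[Px /eqP <-]|Lx].
      by have [] := lineP x Px neq_x.
    by rewrite (subsetP (sub_pts LL)) // (lineE L).
  have := cardsD1 P0 Pts; rewrite PP0; case: plane => -> _ _ _; nia.
have le_pe : #|pencil| <= #|e| by rewrite ce card_pencil.
pose idx x := matching j0 pencil e (line x).
have idx_e x : x \in Pts -> x != P0 -> idx x \in e.
  by move=> Px neq_x; apply: matching_in => //; have [LL L0 _] := lineP x Px neq_x; rewrite inE LL.
have idx_inj x y : x \in Pts -> y \in Pts -> x != P0 -> y != P0 -> idx x = idx y -> line x = line y.
  move=> Px Py neq_x neq_y; apply: matching_inj => //.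
    by have [LL L0 _] := lineP x Px neq_x; rewrite inE LL.
  by have [LL L0 _] := lineP y Py neq_y; rewrite inE LL.
pose f x := if x == P0 then p else matching p (line x :\ P0) (S (idx x)) x.
have le_line x : x \in Pts -> x != P0 -> #|line x :\ P0| <= #|S (idx x)|.
  move=> Px neq_x; have [LL L0 _] := lineP x Px neq_x.
  have [-> _ _] := Sp _ (idx_e x Px neq_x).
  by have := cardsD1 P0 (line x); rewrite L0 card_line //; lia.
have fP0 : f P0 = p by rewrite /f eqxx.
have fS x : x \in Pts -> x != P0 -> f x \in S (idx x).
  move=> Px neq_x; rewrite /f (negPf neq_x) matching_in ?le_line // !inE neq_x.
  by have [] := lineP x Px neq_x.
have f_neq x : x \in Pts -> x != P0 -> f x <> p.
  move=> Px neq_x eq_f; have [_ /negP[]] := Sp _ (idx_e x Px neq_x).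
  by rewrite -[in X in X \in _]eq_f fS.
have inj_f : {in Pts &, injective f}.
  move=> x y Px Py eq_f.
  have [x0|neq_x] := eqVneq x P0; have [y0|neq_y] := eqVneq y P0; first by rewrite x0.
  - by case: (f_neq y Py neq_y); rewrite -eq_f x0.
  - by case: (f_neq x Px neq_x); rewrite eq_f y0.
  have eq_idx : idx x = idx y.
    apply/eqP; apply: contraT => /(dS _ _ (idx_e x Px neq_x) (idx_e y Py neq_y)).
    by rewrite disjoint_subset => /subsetP/(_ _ (fS x Px neq_x)); rewrite inE eq_f fS.
  have eq_l := idx_inj _ _ Px Py neq_x neq_y eq_idx.
  have [_ _ xl] := lineP x Px neq_x; have [_ _ yl] := lineP y Py neq_y.
  move: eq_f; rewrite /f (negPf neq_x) (negPf neq_y) -eq_idx -eq_l.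
  by apply: matching_inj; rewrite ?le_line // !inE ?neq_x ?neq_y // eq_l.
exists f; split=> // L LL; have sLP := subsetP (sub_pts LL).
case: (boolP (P0 \in L)) => L0.
  have cL : #|L :\ P0| = q by have := cardsD1 P0 L; rewrite L0 card_line //; lia.
  have /card_gt0P[z Lz] : 0 < #|L :\ P0| by rewrite cL.
  have [neq_z LLz] := setD1P Lz; have Pz := sLP z LLz.
  have [cS _ ES] := Sp _ (idx_e z Pz neq_z).
  rewrite -(setD1K L0) imsetU1 fP0 (_ : f @: _ = S (idx z)) //.
  apply/eqP; rewrite eqEcard cS; apply/andP; split.
    apply/subsetP=> _ /imsetP[x /setD1P[neq_x Lx] ->].
    have -> : idx z = idx x by rewrite /idx (lineE L) // (lineE L).
    by apply: fS; first exact: sLP.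
  rewrite card_in_imset ?cL // => x y /setD1P[_ Lx] /setD1P[_ Ly].
  by apply: inj_f; apply: sLP.
have neq0 x : x \in L -> x != P0 by apply: contraTneq => ->.
(* Two points of [L] on one line through [P0] would make [L] that line. *)
have idx_injL : {in L &, injective idx}.
  move=> x y Lx Ly /(idx_inj _ _ (sLP x Lx) (sLP y Ly) (neq0 x Lx) (neq0 y Ly)) eq_l.
  apply/eqP; apply: contraT => neq_xy; case/negP: L0.
  have [LLx L0x xLx] := lineP x (sLP x Lx) (neq0 x Lx).
  have [_ _ yLy] := lineP y (sLP y Ly) (neq0 y Ly).
  by rewrite (line_uniq LL LLx neq_xy) // eq_l.
have idxL : idx @: L = e.
  apply/eqP; rewrite eqEcard card_in_imset // card_line // ce leqnn andbT.
  by apply/subsetP=> _ /imsetP[x Lx ->]; apply: idx_e; [exact: sLP | exact: neq0].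
(* [g i] is the image of the point of [L] on the line of the pencil with index [i]. *)
pose g i := f (odflt P0 [pick x in L | idx x == i]).
have gf x : x \in L -> g (idx x) = f x.
  move=> Lx; rewrite /g; case: pickP => [y /andP[Ly /eqP eq_i]|none].
    by rewrite /= (idx_injL y x).
  by case/negP: (negbT (none x)); apply/andP.
have -> : f @: L = g @: e.
  by rewrite -idxL -imset_comp; apply: eq_in_imset => x Lx; rewrite /= gf.
apply: transE => i; rewrite -idxL => /imsetP[x Lx ->].
by rewrite gf // fS ?sLP ?neq0.
Qed.

(** Failure of either of the last two clauses of [plane_free] supplies an embedding: an edge inside
    [common A] is a line at infinity, and q-sets [S i] inside the [V i] with [p] in their
    neighbourhoods give the lines through [p]. *)
Lemma plane_free_of_not_embeds :
  (forall e, e \in E -> #|e| = q.+1) ->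
  (forall S : {set X}, #|S| = q -> #|X| <= 2 * #|nb E S|) -> ~ embeds -> plane_free E q.
Proof.
move=> unif codeg free; split=> // [A leA|J e V p ce dV transE].
  have le_qA : q <= #|A| by nia.
  apply/forallP=> e; apply/implyP=> Ee; apply/negP=> /subsetP sub; case: free.
  apply: (embeds_affine Ee (unif e Ee) leA).
    rewrite disjoint_sym disjoint_subset; apply/subsetP=> x /sub comx.
    by rewrite inE; apply: common_notin comx.
  by move=> x S /sub comx sSA cS; have := common_nb comx sSA cS; rewrite inE => /andP[].
case: (pickP [pred i in e | p \notin touched E q (V i)]) => [i /andP[]|all]; first by exists i.
case: free; pose S i := odflt set0 [pick S : {set X} | [&& S \subset V i, #|S| == q & p \in nb E S]].
have SP i : i \in e -> [/\ S i \subset V i, #|S i| = q & p \in nb E (S i)].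
  move=> ei; have := all i; rewrite /= ei /= => /negbFE; rewrite inE => /existsP[S0 S0P].
  by rewrite /S; case: pickP => [S1 /and3P[? /eqP]|/(_ S0)] //=; rewrite S0P.
apply: (embeds_pointed (e := e) (S := S) (p := p)) => // [i ei|i j ei ej neq_ij|g Sg].
- by have [_ cS] := SP i ei; rewrite inE => /andP[].
- have [sSi _ _] := SP i ei; have [sSj _ _] := SP j ej.
  by apply: disjointWl sSi _; apply: disjointWr sSj _; apply: dV.
by apply: transE => i ei; have [/subsetP sub _ _] := SP i ei; apply/sub/Sg.
Qed.

End ProjectivePlane.

(** * The plane over a finite field *)

Section PG2.
Variable F : finFieldType.
Local Notation V := 'rV[F]_3.
Import GRing.Theory.
Local Open Scope ring_scope.

Definition point_of (v : V) : {set V} := [set a *: v | a : F].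
(** The row space of a matrix gives access to the rank calculus; the height [1 + 1] is that of
    [col_mx u w]. *)
Definition plane_of (M : 'M[F]_(1 + 1, 3)) : {set V} := [set x | (x <= M)%MS].

Lemma mem_point_of v x : (x \in point_of v) = (x <= v)%MS.
Proof. by apply/imsetP/sub_rVP => [[a _ ->]|[a ->]]; exists a. Qed.

Lemma pg_pointP P : reflect (exists2 v, v != 0 & P = point_of v) (pg_point P).
Proof.
apply: (iffP existsP) => [[v /andP[v0 /eqP ->]]|[v v0 ->]]; exists v => //.
by rewrite v0 eqxx.
Qed.

Lemma plane_of_col_mx (u w : V) :
  [set a *: u + b *: w | a : F, b : F] = plane_of (col_mx u w).
Proof.
apply/setP=> x; rewrite inE -addsmxE; apply/imset2P/sub_addsmxP => [[a b _ _ ->]|[[a b] /= ->]].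
  by exists (a%:M, b%:M); rewrite /= !mul_scalar_mx.
by exists (a 0 0) (b 0 0); rewrite // -!mul_scalar_mx -!mx11_scalar.
Qed.

Lemma pg_planeP L : reflect (exists2 M, \rank M = 2%N & L = plane_of M) (pg_plane L).
Proof.
apply: (iffP existsP) => [[u /existsP[w /andP[/eqP rk /eqP ->]]]|[M rk ->]].
  by exists (col_mx u w); rewrite ?plane_of_col_mx.
exists (usubmx M); apply/existsP; exists (dsubmx M).
by rewrite plane_of_col_mx vsubmxK rk !eqxx.
Qed.

Lemma point_sub_plane v M : (point_of v \subset plane_of M) = (v <= M)%MS.
Proof.
apply/subsetP/idP => [/(_ v)|vM x]; first by rewrite mem_point_of inE submx_refl => ->.
by rewrite mem_point_of inE => /submx_trans; apply.
Qed.

Lemma point_of_eq (u v : V) : u != 0 -> v != 0 -> (u <= v)%MS -> point_of u = point_of v.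
Proof.
move=> u0 v0 uv; have /eqmxP eq_uv : (u == v)%MS.
  by rewrite -(mxrank_leqif_eq uv) !rank_rV u0 v0.
by apply/setP=> x; rewrite !mem_point_of eq_uv.
Qed.

Lemma rank_col_mx (u v : V) : u != 0 -> v != 0 -> point_of u != point_of v -> \rank (col_mx u v) = 2%N.
Proof.
move=> u0 v0; apply: contraNeq => rk; have rk1 : \rank u = 1%N by rewrite rank_rV u0.
have le2 : (\rank (col_mx u v) <= 2)%N by apply: rank_leq_row.
have le1 : (\rank u <= \rank (col_mx u v))%N by rewrite mxrankS // -addsmxE addsmxSl.
have eq1 : \rank u = \rank (u + v)%MS by rewrite addsmxE; move: rk le2 le1; rewrite rk1; case: (\rank _) => [|[|[|]]].
have : (u == u + v)%MS by rewrite -(mxrank_leqif_eq (addsmxSl u v)) eq1.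
case/andP=> _; rewrite addsmx_sub => /andP[_ vu].
by rewrite (point_of_eq v0 u0 vu).
Qed.

Lemma plane_of_uniq (M N : 'M[F]_(1 + 1, 3)) (u v : V) : u != 0 -> v != 0 -> point_of u != point_of v ->
  \rank M = 2%N -> \rank N = 2%N -> (u <= M)%MS -> (v <= M)%MS -> (u <= N)%MS -> (v <= N)%MS ->
  plane_of M = plane_of N.
Proof.
move=> u0 v0 neq rM rN uM vM uN vN.
have eqC (Q : 'M[F]_(1 + 1, 3)) : \rank Q = 2%N -> (u <= Q)%MS -> (v <= Q)%MS ->
    plane_of Q = plane_of (col_mx u v).
  move=> rQ uQ vQ; have sub : (col_mx u v <= Q)%MS by rewrite -addsmxE addsmx_sub uQ.
  have /eqmxP eqQ : (col_mx u v == Q)%MS by rewrite -(mxrank_leqif_eq sub) rank_col_mx ?rQ.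
  by apply/setP=> x; rewrite !inE eqQ.
by rewrite (eqC M) ?(eqC N).
Qed.

Lemma card_point_of v : v != 0 -> #|point_of v| = #|F|.
Proof.
move=> v0; rewrite card_imset // => a b /eqP; rewrite -subr_eq0 -scalerBl scaler_eq0 (negPf v0) orbF.
by rewrite subr_eq0 => /eqP.
Qed.

Lemma card_plane_of M : \rank M = 2%N -> #|plane_of M| = (#|F| ^ 2)%N.
Proof.
move=> rM; have inj : injective (fun D : 'rV[F]_(1 + 1) => D *m M).
  by apply: row_free_inj; rewrite /row_free rM.
transitivity #|[set D *m M | D : 'rV[F]_(1 + 1)]|; last by rewrite card_imset // card_mx.
apply: eq_card => x; rewrite inE.
by apply/submxP/imsetP => [[D ->]|[D _ ->]]; exists D.
Qed.

(** The nonzero vectors of [W] are partitioned by the points they span, [#|F| - 1] to each point. *)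
Lemma card_points_in (W : {set V}) : (forall a x, x \in W -> a *: x \in W) -> 0 \in W ->
  (#|[set P : {set V} | pg_point P && (P \subset W)]| * #|F|.-1 = #|W|.-1)%N.
Proof.
move=> scW W0; have -> : #|W|.-1 = #|W :\ 0| by rewrite [#|W|](cardsD1 0) W0.
rewrite -[RHS]sum1_card -sum_nat_const.
rewrite (partition_big point_of (fun P => P \in [set P | pg_point P && (P \subset W)])) /=; last first.
  move=> v /setD1P[v0 Wv]; rewrite inE; apply/andP; split; first by apply/pg_pointP; exists v.
  by apply/subsetP=> _ /imsetP[a _ ->]; apply: scW.
apply: eq_bigr => P; rewrite inE => /andP[/pg_pointP[u u0 ->] sW].
have := cardsD1 0 (point_of u); rewrite card_point_of // mem_point_of sub0mx => -> /=.
rewrite sum1_card; apply: eq_card => x. rewrite [RHS]unfold_in !inE -andbA.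
case: (boolP (x == 0)) => //= x0; rewrite mem_point_of; apply/idP/andP => [xu|[_ /eqP eP]].
  rewrite (point_of_eq x0 u0 xu) eqxx; split=> //; apply: (subsetP sW).
  by rewrite mem_point_of.
by rewrite -mem_point_of -eP mem_point_of.
Qed.

Definition pg_points : {set {set V}} := [set P | pg_point P].
Definition pg_lines : {set {set {set V}}} := [set pg_line L | L in [set L | pg_plane L]].

Lemma card_field_gt1 : (1 < #|F|)%N.
Proof. by apply/card_gt1P; exists 0, 1; rewrite eq_sym oner_eq0. Qed.

(** The counts are the quotients of [q ^ 3 - 1] and [q ^ 2 - 1] by [q - 1]. Two planes share a
    nonzero vector because their ranks sum to 4 in dimension 3. *)
Lemma pg_projective_plane : projective_plane #|F| pg_points pg_lines.
Proof.
have q1 := card_field_gt1; set q := #|F| in q1 *.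
split.
- have := @card_points_in [set: V]; rewrite cardsT card_mx -/q => /(_ _ _)%N.
  rewrite (_ : [set P | _] = pg_points); last by apply/setP=> P; rewrite !inE subsetT andbT.
  move=> cnt; have {}cnt := cnt (fun _ _ _ => in_setT _) (in_setT _).
  by apply/eqP; rewrite -(eqn_pmul2r (_ : 0 < q.-1)%N); [apply/eqP; rewrite cnt|]; nia.
- move=> _ /imsetP[L + ->]; rewrite inE => /pg_planeP[M rM ->]; split.
    by apply/subsetP=> P; rewrite !inE => /andP[].
  have := @card_points_in (plane_of M); rewrite card_plane_of // -/q => cnt.
  have {}cnt : (#|pg_line (plane_of M)| * q.-1 = (q ^ 2).-1)%N.
    apply: cnt; last by rewrite inE sub0mx.
    by move=> a x; rewrite !inE; apply: scalemx_sub.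
  by apply/eqP; rewrite -(eqn_pmul2r (_ : 0 < q.-1)%N); [apply/eqP; rewrite cnt|]; nia.
- move=> P Q; rewrite !inE => pP pQ; case/pg_pointP: (pP) => u u0 eP; case/pg_pointP: (pQ) => v v0 eQ neq.
  rewrite eP eQ in neq.
  exists (pg_line (plane_of (col_mx u v))); split.
  + by apply: imset_f; rewrite inE; apply/pg_planeP; exists (col_mx u v); rewrite ?rank_col_mx.
  + by rewrite inE pP eP point_sub_plane -addsmxE addsmxSl.
  by rewrite inE pQ eQ point_sub_plane -addsmxE addsmxSr.
move=> _ _ /imsetP[L1 + ->] /imsetP[L2 + ->]; rewrite !inE.
move=> /pg_planeP[M rM ->] /pg_planeP[N rN ->] neq.
have /rowV0Pn[v vMN v0] : (M :&: N)%MS != 0.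
  rewrite -mxrank_eq0; have := mxrank_sum_cap M N; have := rank_leq_col (M + N)%MS.
  by rewrite rM rN; lia.
rewrite sub_capmx in vMN; have /andP[vM vN] := vMN.
apply/eqP/cards1P; exists (point_of v); apply/setP=> P; rewrite !inE.
apply/idP/eqP => [/andP[/andP[/pg_pointP[u u0 ->]]] uM /andP[_ uN]|->]; last first.
  by rewrite !point_sub_plane vM vN !andbT andbb; apply/pg_pointP; exists v.
rewrite !point_sub_plane in uM uN.
apply/eqP; apply: contraNT neq => neq; apply/eqP; congr (pg_line _).
exact: (plane_of_uniq u0 v0 neq).
Qed.

End PG2.

(** * Transfer to hypergraphs on an initial segment of the integers *)

(** Uniformity makes every member of [nbhd E S] a singleton, whose element lies in [nb E S]. *)
Lemma card_nbhd_leq n q (E : {set {set 'I_n}}) (S : {set 'I_n}) :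
  uniform q.+1 E -> #|S| = q -> #|nbhd E S| <= #|nb E S|.
Proof.
move=> unif cS; apply: leq_trans (leq_imset_card (fun x : 'I_n => [set x]) _).
apply/subset_leq_card/subsetP=> T; rewrite inE => /andP[dTS ET].
have := unif _ ET; have := cardsUI S T; rewrite cS setIC (eqP (_ : T :&: S == set0)) ?setI_eq0 //.
rewrite cards0 addn0 => -> /eqP; rewrite -addn1 eqn_add2l => /cards1P[x eT].
rewrite eT in dTS ET *; apply: imset_f; rewrite inE setUC ET andbT.
by rewrite disjoints1 in dTS.
Qed.

Theorem mainTheorem13 (q : nat) (hq : prime_power q) :
  exists n0 : nat, forall (n : nat) (E : {set {set 'I_n}}),
    (n0 < n)%N ->
    uniform q.+1 E ->
    min_codeg_half q E ->
    ~ contains_PG2 q E ->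
    ~~ odd n /\
    exists X0 : {set 'I_n},
      (2 * #|X0| = n)%N /\ (2 * #|~: X0| = n)%N /\
      (forall e, e \in E -> ~~ (e \subset X0)) /\
      (forall e, e \in E -> ~~ (e \subset ~: X0)).
Proof.
have [p [k [p_prime [k_gt0 q_def]]]] := hq.
(* An embedding of the plane over this one field of order [q] already contradicts the hypothesis on
   [E]. *)
have [F _ cF] := pPrimePowerField p_prime k_gt0.
have {}cF : #|F| = q by rewrite q_def.
have q_gt0 : 0 < q by rewrite -cF ltnW ?card_field_gt1.
have [n0 bip] := plane_free_bipartition q_gt0.
exists n0 => n E lt_n unif codeg noPG.
have free : plane_free E q.
  have := pg_projective_plane F; rewrite cF => plane.
  apply: (plane_free_of_not_embeds q_gt0 plane unif) => [S cS|[f [inj_f fE]]].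
    rewrite card_ord; apply: leq_trans (codeg S cS) _.
    by rewrite leq_mul2l (card_nbhd_leq unif cS) orbT.
  apply: noPG; exists F; split=> //; exists f; split.
    by move=> P Q pP pQ; apply: inj_f; rewrite inE.
  by move=> L pL; apply: fE; apply: imset_f; rewrite inE.
have [|X0 cX0 [/forallP ind0 /forallP ind1]] := bip _ E free; first by rewrite card_ord ltnW.
rewrite card_ord in cX0.
split; first by rewrite -cX0 oddM.
exists X0; split=> //; split; first by have := cardsC X0; rewrite card_ord; lia.
by split=> e; apply/implyP.
Qed.
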